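(* Let $A:\mathcal{B}\to\mathbb{R}$ be Lipschitz. Then there exists a Lipschitz function $u:\mathcal{B}\to\mathbb{R}$ which is a calibrated subaction for $A$. As a consequence, $$\lim_{\beta\to\infty}\frac1\beta\log\lambda_\beta=m(A).$$
   Context: $M=\mathbb{S}^1$ with its usual metric $d$ and Lebesgue probability measure $da$. $\mathcal{B}=M^{\mathbb{N}}$ is the space of sequences $x=(x_0,x_1,\dots)$ with the metric $d(x,y)=\sum_{k\ge 0} d(x_k,y_k)/2^k$, and $\sigma(x_0,x_1,x_2,\dots)=(x_1,x_2,\dots)$ is the shift. For $a\in M$, $ax=(a,x_0,x_1,\dots)$. $\mathcal{M}_\sigma$ is the set of $\sigma$-invariant Borel probability measures on $\mathcal{B}$ and $m(A)=\max_{\mu\in\mathcal{M}_\sigma}\int A\,d\mu$. A continuous function $u:\mathcal{B}\to\mathbb{R}$ is a calibrated subaction for $A$ if for every $y\in\mathcal{B}$, $u(y)=\max_{\sigma(x)=y}[A(x)+u(x)-m(A)]$. For $\beta>0$, $\lambda_\beta$ is the main eigenvalue (the positive eigenvalue equal to the spectral radius, associated to a strictly positive eigenfunction) of the Ruelle operator $\mathcal{L}_{\beta A}$ acting on continuous functions $\psi:\mathcal{B}\to\mathbb{R}$ by $\mathcal{L}_{\beta A}(\psi)(x)=\int_M e^{\beta A(ax)}\psi(ax)\,da$. *)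

(* Defs.v *)
From HB Require Import structures.
From mathcomp Require Import all_boot all_order all_algebra.
From mathcomp Require Import archimedean ring lra complex.
From mathcomp Require Import all_classical all_reals all_analysis.
From mathcomp Require Import measurable_realfun.

Set Implicit Arguments.
Unset Strict Implicit.
Unset Printing Implicit Defensive.

Import Order.TTheory GRing.Theory Num.Theory.
Import numFieldNormedType.Exports.

Local Open Scope classical_set_scope.
Local Open Scope ring_scope.

(** The circle, realised as [R/Z]: a point is its representative in [0, 1).
    The distance is the arc length, for a circle of total length 1. *)
Record circle (R : realType) := Circle {
  circle_val : R ;
  circle_itv : 0 <= circle_val < 1
}.

Section Circle.
Variable R : realType.
Implicit Types x y z : circle R.

HB.instance Definition _ := [isSub for @circle_val R].
HB.instance Definition _ := [Choice of circle R by <:].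

Definition circle_dist x y : R :=
  Num.min `|circle_val x - circle_val y| (1 - `|circle_val x - circle_val y|).

Lemma circle_distxx x : circle_dist x x = 0.
Proof. by rewrite /circle_dist subrr normr0 subr0 minElt ltr01. Qed.

Lemma circle_dist_eq0 x y : circle_dist x y = 0 -> x = y.
Proof.
case: x y => [x x01] [y y01]; rewrite /circle_dist /= => h.
apply/val_inj => /=; move: x01 y01 h => /andP[? ?] /andP[? ?].
by rewrite minElt; case: (ger0P (x - y)) => ?; case: ifPn => _; lra.
Qed.

Lemma circle_dist_sym x y : circle_dist x y = circle_dist y x.
Proof. by rewrite /circle_dist distrC. Qed.

Lemma circle_dist_triangle y x z :
  circle_dist x z <= circle_dist x y + circle_dist y z.
Proof.
move: (circle_itv x) (circle_itv y) (circle_itv z); rewrite /circle_dist.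
move: (circle_val x) (circle_val y) (circle_val z) => a b c.
move=> /andP[? ?] /andP[? ?] /andP[? ?]; rewrite !minEle.
case: (ger0P (a - c)) => ?; case: (ger0P (a - b)) => ?;
  case: (ger0P (b - c)) => ?; do 3 (case: ifPn; rewrite -?ltNge => ?); lra.
Qed.

HB.instance Definition _ := isMetric.Build R (circle R)
  circle_distxx circle_dist_eq0 circle_dist_sym circle_dist_triangle.

Let frac_itv (t : R) : 0 <= t - (Num.floor t)%:~R < 1.
Proof. by have /andP[] := floor_itv t; rewrite intrD; lra. Qed.

Definition circle_of (t : R) : circle R := Circle (frac_itv t).

HB.instance Definition _ := isPointed.Build (circle R) (circle_of 0).

Lemma circle_of_lipschitz s t : mdist (circle_of s) (circle_of t) <= `|s - t|.
Proof.
rewrite [mdist _ _]/(circle_dist _ _) /circle_dist /=.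
have [k ->] : exists k : int, s - t =
    (s - (Num.floor s)%:~R) - (t - (Num.floor t)%:~R) + k%:~R.
  by exists (Num.floor s - Num.floor t); rewrite intrB; ring.
move: (frac_itv s) (frac_itv t); move: (s - _) (t - _) => a b.
move=> /andP[? ?] /andP[? ?].
have [->|k0] := eqVneq k 0; first by rewrite addr0 ge_min lexx.
have : 1 <= `|k%:~R : R| by rewrite norm_intr_ge1 // intr_eq0.
rewrite ge_min; move: (k%:~R) => c; case: (ger0P (a - b)) => ?;
  case: (ger0P c) => ?; case: (ger0P (a - b + c)) => ? ?;
  apply/orP; right; lra.
Qed.

End Circle.

Notation borel T := (g_sigma_algebraType (@open T)).

Section LebesgueProbability.
Variable R : realType.

(** [circle_of], with the Borel sigma-algebra on its codomain. *)
Definition circle_rv (t : measurableTypeR R) : borel (circle R) := circle_of t.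

Lemma measurable_circle_rv : measurable_fun [set: measurableTypeR R] circle_rv.
Proof.
apply: (@measurability _ _ _ (borel (circle R)) setT circle_rv
  (@open (circle R)) erefl).
move=> _ [B oB <-]; rewrite setTI.
apply: open_measurable; rewrite openE => t /= Bt.
have /nbhs_ballP[e /= e0 eB] : nbhs (circle_of t) B by exact: open_nbhs_nbhs.
apply/nbhs_ballP; exists e => //= s ts; apply: eB.
rewrite ballEmdist /=; apply: le_lt_trans (circle_of_lipschitz t s) _.
exact: ts.
Qed.

HB.instance Definition _ :=
  isMeasurableFun.Build _ _ (measurableTypeR R) (borel (circle R))
    circle_rv measurable_circle_rv.

(** The Lebesgue probability on the circle: the image under [R -> R/Z] of
    Lebesgue measure on [0, 1]. *)
Definition circle_leb : probability (borel (circle R)) R :=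
  distribution (uniform_prob (@ltr01 R)) circle_rv.

End LebesgueProbability.

Definition seqspace (R : realType) : Type := nat -> circle R.

Section SequenceSpace.
Variable R : realType.
Implicit Types x y z : seqspace R.

HB.instance Definition _ := gen_eqMixin (seqspace R).
HB.instance Definition _ := gen_choiceMixin (seqspace R).
HB.instance Definition _ := isPointed.Build (seqspace R) (fun=> point).

Definition seq_dist x y : R :=
  limn (series (fun k => mdist (x k) (y k) / 2 ^+ k)).

Lemma is_cvg_seq_dist x y :
  cvgn (series (fun k => mdist (x k) (y k) / 2 ^+ k : R)).
Proof.
apply: (@series_le_cvg _ _ (geometric 1 2^-1)).
- by move=> k; rewrite divr_ge0 ?mdist_ge0.
- by move=> k; rewrite /geometric /= mul1r exprn_ge0.
- move=> k; rewrite /geometric /= mul1r exprVn ler_piMl ?invr_ge0//.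
  rewrite [mdist _ _]/(circle_dist _ _) ge_min; apply/orP; right.
  by rewrite lerBlDr lerDl.
- by apply: is_cvg_geometric_series; rewrite ger0_norm ?invf_lt1 ?ltr1n.
Qed.

Lemma seq_distxx x : seq_dist x x = 0.
Proof.
rewrite /seq_dist (_ : series _ = cst 0) ?lim_cst//.
by apply/funext => n; rewrite /series /= big1 // => k _; rewrite mdistxx mul0r.
Qed.

Lemma seq_dist_eq0 x y : seq_dist x y = 0 -> x = y.
Proof.
move=> xy0; apply/funext => k; apply: (@mdist_positivity R).
have ndc : nondecreasing_seq (series (fun k => mdist (x k) (y k) / 2 ^+ k : R)).
  by apply: nondecreasing_series => i _ _; rewrite divr_ge0 ?mdist_ge0.
have := nondecreasing_cvgn_le ndc (@is_cvg_seq_dist x y) k.+1.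
rewrite -[limn _]/(seq_dist x y) xy0 seriesEnat /= big_nat_recr //= => h.
apply/eqP; rewrite eq_le mdist_ge0 andbT.
rewrite -(@pmulr_lle0 _ (2 ^+ k)^-1) ?invr_gt0 ?exprn_gt0 //.
apply: le_trans h; rewrite lerDr sumr_ge0 // => i _.
by rewrite divr_ge0 ?mdist_ge0.
Qed.

Lemma seq_dist_sym x y : seq_dist x y = seq_dist y x.
Proof.
by congr (limn (series _)); apply/funext => k; rewrite metric_sym.
Qed.

Lemma seq_dist_triangle y x z : seq_dist x z <= seq_dist x y + seq_dist y z.
Proof.
rewrite /seq_dist -lim_seriesD; [|exact: is_cvg_seq_dist..].
apply: lim_series_le; first exact: is_cvg_seq_dist.
  by apply: is_cvg_seriesD; exact: is_cvg_seq_dist.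
by move=> k; rewrite /= -mulrDl ler_pM2r ?metric_triangle.
Qed.

HB.instance Definition _ := isMetric.Build R (seqspace R)
  seq_distxx seq_dist_eq0 seq_dist_sym seq_dist_triangle.

Definition seq_shift x : seqspace R := fun k => x k.+1.

Definition prepend (a : circle R) x : seqspace R :=
  fun k => if k is k'.+1 then x k' else a.

Definition lipschitz_fun (f : seqspace R -> R) :=
  exists K : R, forall x y, `|f x - f y| <= K * mdist x y.

Definition shift_invariant (mu : probability (borel (seqspace R)) R) :=
  forall E : set (borel (seqspace R)), measurable E -> mu (seq_shift @^-1` E) = mu E.

(** For continuous [A] the maximum of the integrals exists, by weak-*
    compactness of the set of invariant probabilities; it is the [sup]. *)
Definition max_integral (A : seqspace R -> R) : R :=
  sup [set \int[mu]_x A x | mu in shift_invariant].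

Definition is_max (S : set R) (v : R) := S v /\ ubound S v.

Definition calibrated_subaction (A u : seqspace R -> R) :=
  continuous u /\
  forall y, is_max [set A x + u x - max_integral A | x in [set x | seq_shift x = y]]
                   (u y).

Definition ruelle (A psi : seqspace R -> R) : seqspace R -> R :=
  fun x => \int[@circle_leb R]_a (expR (A (prepend a x)) * psi (prepend a x)).

End SequenceSpace.

(** The spectrum of an operator on the real Banach space of continuous functions
    is that of its complexification, which acts on real and imaginary parts. *)
Section Spectrum.
Variable R : realType.
Implicit Types (L : (seqspace R -> R) -> seqspace R -> R).

Definition ccontinuous (f : seqspace R -> R[i]) :=
  continuous (fun x => complex.Re (f x)) /\
  continuous (fun x => complex.Im (f x)).

Definition complexify L (f : seqspace R -> R[i]) : seqspace R -> R[i] :=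
  fun x => (L (fun t => complex.Re (f t)) x +i*
            L (fun t => complex.Im (f t)) x)%C.

(** Bijectivity of [z - L] on continuous functions is enough: for a bounded [L]
    the inverse is then bounded by the open mapping theorem. *)
Definition spectrum L : set R[i] :=
  [set z | ~ forall g, ccontinuous g ->
     exists! f, ccontinuous f /\ forall x, z * f x - complexify L f x = g x].

Definition spectral_radius L : R :=
  sup [set ComplexField.Normc.normc z | z in spectrum L].

Definition is_main_eigenvalue L (l : R) :=
  [/\ 0 < l, l = spectral_radius L &
      exists h : seqspace R -> R,
        [/\ continuous h, forall x, 0 < h x & forall x, L h x = l * h x]].

(** At most one [l] qualifies, since [spectral_radius L] determines it; the
    value is 0 when there is none. *)
Definition main_eigenvalue L : R := xget 0 [set l | is_main_eigenvalue L l].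

End Spectrum.

(* Main.v *)
Require Import Defs.
From mathcomp Require Import all_boot all_order all_algebra.
From mathcomp Require Import archimedean ring lra complex.
From mathcomp Require Import all_classical all_reals all_analysis.
From mathcomp Require Import measurable_realfun.

(** The subaction equation, and the eigenfunction equation of the Ruelle
    operator after taking logarithms, have the same form: S u = u + c, where
    S u y is obtained by applying to the function a |-> A (ay) + u (ay) a
    monotone functional commuting with constants. For the subaction the
    functional is the maximum, for the Ruelle operator it is the logarithm of
    the integral of the exponential. Since prepending a letter halves
    distances, S preserves the K-Lipschitz functions when A is K-Lipschitz.

    One argument solves both equations ([topical_eigenproblem]). The iterates
    of 0 are K-Lipschitz, hence oscillate by at most K, so S^n 0 = n c + O(1)
    for some slope c. The limsup g of S^n 0 - n c satisfies S g >= g + c, and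
    S^n g - n c then increases to a solution. Only monotone sequences of
    K-Lipschitz functions occur; on a compact space they converge uniformly
    ([klip_cvg_uniform]), and S is nonexpansive for the sup norm.

    For the maximum, the constant c is m(A) ([max_integralE]). Integrating
    A <= u o sigma - u + c against an invariant measure bounds its integral by
    c. Conversely, n letters of a maximising backward orbit, repeated
    periodically, give a periodic point whose Birkhoff sum is n c + O(1); the
    uniform measure on its orbit is invariant and has integral c + O(1/n).

    For the log-integral, e^u is a positive eigenfunction with eigenvalue
    l = e^c. This l is the spectral radius ([spectral_radius_eigenvalue]): the
    operator has norm at most l for the sup norm weighted by the
    eigenfunction, also on complex functions by positivity, so z - L is
    inverted by a contracting iteration when |z| > l, and l itself is an
    eigenvalue.

    Finally let u be a subaction for A and e^v an eigenfunction at inverse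
    temperature b with eigenvalue e^c. Comparing the two equations at a maximum
    point of v - b u gives c <= b m(A); at a minimum point, since an arc of
    length d has mass d, it gives c >= b m(A) - b C d + ln d
    ([log_eigenvalue_bounds]). Divide by b, let b tend to infinity, then d to
    0. *)

Set Implicit Arguments.
Unset Strict Implicit.
Unset Printing Implicit Defensive.

Import Order.TTheory GRing.Theory Num.Theory.
Import numFieldNormedType.Exports.

Local Open Scope classical_set_scope.
Local Open Scope ring_scope.

(** * Lipschitz functions on compact metric spaces *)

Section CompactMetric.
Variables (R : realType) (T : metricType R).
Implicit Types (f g : T -> R) (K : R).

(** A one-sided bound, which is what gets transported by monotone operators;
    exchanging the points gives the two-sided one. *)
Definition klip K f := forall x y, f x - f y <= K * mdist x y.

Lemma klip_norm K f x y : klip K f -> `|f x - f y| <= K * mdist x y.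
Proof.
by move=> fK; rewrite ler_norml fK lerNl opprB metric_sym fK.
Qed.

Lemma mdist_continuous f :
  (forall x (e : R), 0 < e -> exists2 d : R, 0 < d &
    forall y, mdist x y < d -> `|f x - f y| < e) -> continuous f.
Proof.
move=> fd x; apply/cvgrPdist_lt => e /(fd x)[d d0 df].
by apply/nbhs_ballP; exists d => // y; rewrite ballEmdist; exact: df.
Qed.

Lemma klip_continuous K f : klip K f -> continuous f.
Proof.
move=> fK; apply: mdist_continuous => x e e0.
have K1 : 0 < `|K| + 1 by rewrite ltr_wpDl.
exists (e / (`|K| + 1)) => [|y]; first by rewrite divr_gt0.
rewrite ltr_pdivlMr// => xy.
apply: le_lt_trans (klip_norm _ _ fK) _; apply: le_lt_trans xy.
rewrite mulrC ler_wpM2l ?mdist_ge0//.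
by rewrite (le_trans (ler_norm _))// lerDl.
Qed.

Lemma continuous_mdist f x (e : R) : continuous f -> 0 < e ->
  exists2 d : R, 0 < d & forall y, mdist x y < d -> `|f x - f y| < e.
Proof.
move=> cf e0; have /cvgrPdist_lt/(_ e e0) /nbhs_ballP[r /= r0 rf] := cf x.
by exists r => // y xy; apply: rf; rewrite ballEmdist.
Qed.

Hypothesis cT : compact [set: T].

Lemma compact_unif_cont f : continuous f -> forall e : R, 0 < e ->
  exists2 d : R, 0 < d & forall x y, mdist x y < d -> `|f x - f y| < e.
Proof.
move=> cf e e0; have := cT; rewrite compact_near_coveringP => nT.
pose P (d : R) x := forall y, mdist x y < d -> `|f x - f y| < e.
have /(nT R 0^'+ P) : forall x, [set: T] x ->
    \forall x' \near x & d \near 0^'+, P d x'.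
  move=> x _; have [|r r0 rfx] := @continuous_mdist f x (e / 2) cf.
    by rewrite divr_gt0.
  have step y d : mdist x y < r / 2 -> d < r / 2 -> P d y.
    move=> xy dr z yz; have := metric_triangle x y z => tri.
    have := ler_normD (f x - f z) (f y - f x).
    have -> : f x - f z + (f y - f x) = f y - f z by ring.
    have xz : mdist x z < r by lra.
    have {}xy : mdist x y < r by lra.
    have := rfx _ xz; have := rfx _ xy; rewrite (distrC (f y) (f x)); lra.
  near=> y d.
  have xy : mdist x y < r / 2.
    near: y; apply/nbhs_ballP; exists (r / 2); rewrite /= ?divr_gt0// => t.
    by rewrite ballEmdist.
  have dr : d < r / 2 by near: d; apply: nbhs_right_lt; rewrite divr_gt0.
  exact: step xy dr.
move=> /nbhs_ballP[d /= d0 dP]; exists (d / 2); first by rewrite divr_gt0.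
move=> x y xy; apply: (dP (d / 2)) => //=; last by rewrite divr_gt0.
by rewrite /ball /= sub0r normrN gtr0_norm ?divr_gt0// ltr_pdivrMr// ltr_pMr// ltr1n.
Unshelve. all: by end_near. Qed.

Lemma compact_bounded_fun f : continuous f -> exists M, forall x, `|f x| <= M.
Proof.
move=> cf; have : compact (f @` [set: T]).
  by apply: continuous_compact => //; apply: continuous_subspaceT.
move=> /compact_bounded[M [_ /(_ (M + 1))]].
rewrite ltrDl ltr01 => /(_ isT) h; exists (M + 1) => x.
by apply: h; exists x.
Qed.

(** On a compact space an equi-Lipschitz sequence that converges pointwise
    converges uniformly, to a function with the same constant: near each point
    the Lipschitz bounds reduce the estimate to that point. *)
Lemma klip_cvg_uniform K (F : nat -> T -> R) f : (forall n, klip K (F n)) ->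
    (forall x, F n x @[n --> \oo] --> f x) ->
  klip K f /\ forall e : R, 0 < e -> \forall n \near \oo, forall x, `|F n x - f x| < e.
Proof.
move=> FK Ff.
have fK : klip K f.
  move=> x y; have : F n x - F n y @[n --> \oo] --> f x - f y by apply: cvgB.
  move=> h; rewrite -(cvg_lim _ h)//.
  apply: limr_le; first by apply/cvg_ex; exists (f x - f y).
  by near=> n; exact: FK.
split => // e e0; have := cT; rewrite compact_near_coveringP => nT.
pose P n x := `|F n x - f x| < e.
suff /(nT nat \oo P) : forall x, [set: T] x ->
    \forall x' \near x & n \near \oo, P n x'.
  by apply: filterS => n h x; exact: h.
move=> x _.
have K1 : 0 < `|K| + 1 by rewrite ltr_wpDl.
have step y n : (`|K| + 1) * mdist y x < e / 3 -> `|F n x - f x| < e / 3 -> P n y.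
  move=> xy Fx.
  have Kxy : K * mdist y x <= (`|K| + 1) * mdist y x.
    by rewrite ler_wpM2r ?mdist_ge0// (le_trans (ler_norm _))// lerDl.
  have Fn := klip_norm y x (FK n); have fn := klip_norm y x fK.
  rewrite /P; have -> : F n y - f y =
      (F n y - F n x) + (F n x - f x) - (f y - f x) by ring.
  apply: le_lt_trans (ler_normB _ _) _.
  by have := ler_normD (F n y - F n x) (F n x - f x); lra.
near=> y n.
have xy : (`|K| + 1) * mdist y x < e / 3.
  rewrite mulrC -ltr_pdivlMr// metric_sym.
  near: y; apply/nbhs_ballP; exists (e / 3 / (`|K| + 1)).
    by rewrite /= !divr_gt0.
  by move=> t; rewrite ballEmdist.
have Fx : `|F n x - f x| < e / 3.
  near: n; have /cvgrPdist_lt/(_ (e / 3)) := Ff x.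
  rewrite divr_gt0// => /(_ isT); apply: filterS => n.
  by rewrite distrC.
exact: step xy Fx.
Unshelve. all: by end_near. Qed.

End CompactMetric.

(** * Geometry and compactness of the sequence space *)

Section SeqGeometry.
Variable R : realType.
Implicit Types (x y : seqspace R) (a : circle R).

Lemma seq_dist_rec x y :
  mdist x y = mdist (x 0) (y 0) + mdist (seq_shift x) (seq_shift y) / 2.
Proof.
rewrite -[mdist x y]/(seq_dist x y) -[mdist (seq_shift x) _]/(seq_dist _ _).
pose f x y := (fun k => mdist (x k) (y k) / 2 ^+ k : R).
have h1 : series (f x y) n @[n --> \oo] --> seq_dist x y.
  exact: is_cvg_seq_dist.
have h2 : series (f (seq_shift x) (seq_shift y)) n @[n --> \oo] -->
    seq_dist (seq_shift x) (seq_shift y) by exact: is_cvg_seq_dist.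
have h3 : series (f x y) n.+1 @[n --> \oo] --> seq_dist x y.
  by rewrite (cvg_shiftS (series (f x y))).
have h4 : series (f x y) n.+1 @[n --> \oo] -->
   mdist (x 0) (y 0) + seq_dist (seq_shift x) (seq_shift y) / 2.
  under eq_fun do rewrite seriesEnat /= big_nat_recl //.
  rewrite /f expr0 divr1; apply: cvgD; first exact: cvg_cst.
  under eq_fun => n.
    under eq_bigr do rewrite exprSr invfM mulrA.
    rewrite -mulr_suml; over.
  apply: cvgM; last exact: cvg_cst.
  by move: h2; rewrite seriesEnat.
by rewrite -(cvg_lim _ h3)// (cvg_lim _ h4).
Qed.

Lemma circle_ofK a : circle_of (circle_val a) = a.
Proof.
apply/val_inj => /=; have /andP[a0 a1] := circle_itv a.
have -> : Num.floor (circle_val a) = 0 by apply/eqP; rewrite floor_eq /= a0 add0r.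
by rewrite subr0.
Qed.

Lemma circle_dist_le a b : mdist a b <= 2^-1 :> R.
Proof.
rewrite [mdist _ _]/(circle_dist _ _) /circle_dist ge_min -implyNb -ltNge.
by apply/implyP; lra.
Qed.

Lemma seq_dist_le1 x y : mdist x y <= 1 :> R.
Proof.
rewrite -[mdist x y]/(seq_dist x y).
have h2 : `|2^-1 : R| < 1 by rewrite gtr0_norm ?invr_gt0// invf_lt1 ?ltr1n.
have := @cvg_geometric_series R 2^-1 2^-1 h2.
have -> : 2^-1 * (1 - 2^-1)^-1 = 1 :> R by field.
move=> h; rewrite -(cvg_lim _ h)//; apply: lim_series_le.
- exact: is_cvg_seq_dist.
- exact: is_cvg_geometric_series.
- move=> k; rewrite /geometric /= exprVn ler_pM2r ?invr_gt0 ?exprn_gt0//.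
  exact: circle_dist_le.
Qed.

Lemma mdist_prepend2 a x y : mdist (prepend a x) (prepend a y) = mdist x y / 2.
Proof. by rewrite seq_dist_rec mdistxx add0r. Qed.

Lemma mdist_prepend1 a b x : mdist (prepend a x) (prepend b x) = mdist a b.
Proof. by rewrite seq_dist_rec [X in _ + X / _]mdistxx mul0r addr0. Qed.

Lemma prepend_seq_shift x : prepend (x 0%N) (seq_shift x) = x.
Proof. by apply/funext => -[]. Qed.

Lemma seq_dist_agree n x y : (forall i, (i < n)%N -> x i = y i) ->
  mdist x y <= 2^-1 ^+ n.
Proof.
elim: n x y => [|n IH] x y xy; first by rewrite expr0 seq_dist_le1.
rewrite seq_dist_rec xy// mdistxx add0r exprSr ler_pM2r ?invr_gt0//.
by apply: IH => i ni; apply: xy.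
Qed.

Lemma seq_dist_close n (e : R) x y : (forall i, (i < n)%N -> mdist (x i) (y i) < e) ->
  0 < e -> mdist x y <= 2 * e + 2^-1 ^+ n.
Proof.
move=> xy e0; elim: n x y xy => [|n IH] x y xy.
  by rewrite expr0; have := seq_dist_le1 x y; lra.
have := IH (seq_shift x) (seq_shift y) (fun i ni => xy i.+1 ni).
by rewrite [mdist x y]seq_dist_rec exprSr; have := xy 0%N isT; lra.
Qed.

(** The product of copies of [R] carries the topology for which Tychonoff's
    theorem is stated; [seqspace R] carries the topology of its metric. *)
Definition seq_of_reals (t : prod_topology (fun=> R)) : seqspace R :=
  fun k => circle_of (t k).

Lemma near_coord (t : prod_topology (fun=> R)) (m : nat) (e : R) : 0 < e ->
  nbhs t [set s : prod_topology (fun=> R) | `|t m - s m| < e].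
Proof.
move=> e0; apply: (@proj_continuous nat (fun=> R) m t [set r | `|t m - r| < e]).
by apply/(@nbhs_ballP R R); exists e.
Qed.

Lemma continuous_seq_of_reals : continuous seq_of_reals.
Proof.
move=> t U /(@nbhs_ballP R (seqspace R))[e /= e0 eU].
have e8 : 0 < e / 8 by rewrite divr_gt0.
have [n _ /(_ n (leqnn n))/= hn] : \forall n \near \oo, (2^-1 : R) ^+ n < e / 2.
  have : (2^-1 : R) ^+ n @[n --> \oo] --> (0 : R).
    by apply: cvg_expr; rewrite gtr0_norm ?invr_gt0// invf_lt1 ?ltr1n.
  move=> /cvgrPdist_lt/(_ (e / 2)); rewrite divr_gt0// => /(_ isT).
  by apply: filterS => n; rewrite sub0r normrN ger0_norm ?exprn_ge0// ?invr_ge0.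
have near_lt m : \forall s \near t,
    forall i, (i < m)%N -> mdist (seq_of_reals t i) (seq_of_reals s i) < e / 8.
  elim: m => [|m IH]; first exact: filterE.
  apply: filterS2 (near_coord t m e8) IH => s ms IH i; rewrite ltnS leq_eqVlt => /orP[/eqP ->|].
    by apply: le_lt_trans (circle_of_lipschitz _ _) ms.
  exact: IH.
apply: filterS (near_lt n) => s ts; apply: eU; rewrite ballEmdist /=.
by have := seq_dist_close ts e8; lra.
Qed.

Lemma compact_seqspace : compact [set: seqspace R].
Proof.
have -> : [set: seqspace R] =
    seq_of_reals @` [set t | forall i, `[0, 1]%classic (t i)].
  apply/seteqP; split => // x _; exists (fun k => circle_val (x k)).
    by move=> i /=; rewrite in_itv /=; have /andP[-> /ltW ->] := circle_itv (x i).
  by apply/funext => k; exact: circle_ofK.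
apply: (@continuous_compact (prod_topology (fun=> R)) (seqspace R)).
  by apply: continuous_subspaceT; exact: continuous_seq_of_reals.
apply: (@tychonoff nat (fun=> R) (fun=> `[0, 1]%classic)) => _.
exact: segment_compact.
Qed.

End SeqGeometry.

(** * Additive eigenfunctions of monotone operators *)

(** Additivity up to a bounded error, applied [k] times and [n] times to
    [a (k * n)], gives (a n - K) / n <= (a k + K) / k for all [n] and [k]; any
    number between the two families is a slope. *)
Lemma quasi_additive_slope (R : realType) (K : R) (a : nat -> R) :
    (forall m n, `|a (m + n)%N - a m - a n| <= K) ->
  exists c, forall n, `|a n - n%:R * c| <= K.
Proof.
move=> aK.
have a0 : `|a 0%N| <= K.
  have := aK 0%N 0%N; rewrite addn0.
  by rewrite subrr sub0r normrN.
have K0 : 0 <= K by apply: le_trans a0; exact: normr_ge0.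
have aM n k : `|a (k.+1 * n)%N - k.+1%:R * a n| <= k%:R * K.
  elim: k => [|k IH]; first by rewrite mul1n mul1r mul0r subrr normr0.
  have := aK n (k.+1 * n)%N; rewrite -mulSn => h.
  have -> : a (k.+2 * n)%N - k.+2%:R * a n =
     (a (k.+2 * n)%N - a n - a (k.+1 * n)%N) +
     (a (k.+1 * n)%N - k.+1%:R * a n).
    have -> : k.+2%:R = k.+1%:R + 1 :> R by rewrite natr1.
    by ring.
  apply: le_trans (ler_normD _ _) _.
  have -> : k.+1%:R * K = k%:R * K + K by rewrite -natr1; ring.
  by move: h IH; lra.
have cmp n k : (a n.+1 - K) / n.+1%:R <= (a k.+1 + K) / k.+1%:R.
  rewrite ler_pdivrMr ?ltr0n// mulrAC ler_pdivlMr ?ltr0n//.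
  have := aM n.+1 k; have := aM k.+1 n; rewrite (mulnC n.+1).
  rewrite !ler_norml -!natr1 => /andP[h1 h2] /andP[h3 h4].
  move: h1 h2 h3 h4.
  move: (a (k.+1 * n.+1)%N) (a k.+1) (a n.+1) => x y z.
  have : 0 <= n%:R :> R by [].
  have : 0 <= k%:R :> R by [].
  by move: (n%:R : R) (k%:R : R) => p q; nra.
pose E := [set (a n.+1 - K) / n.+1%:R | n in [set: nat]].
have supE : has_sup E.
  split; first by exists ((a 1%N - K) / 1); exists 0%N.
  by exists ((a 1%N + K) / 1) => _ [n _ <-]; exact: cmp.
exists (sup E) => -[|n]; first by rewrite mul0r subr0.
have lo : (a n.+1 - K) / n.+1%:R <= sup E.
  by apply: ub_le_sup; [case: supE | exists n].
have hi : sup E <= (a n.+1 + K) / n.+1%:R.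
  by apply: ge_sup; [case: supE | move=> _ [m _ <-]; exact: cmp].
move: lo hi; rewrite ler_pdivrMr ?ltr0n// ler_pdivlMr ?ltr0n// => lo hi.
by rewrite ler_norml; apply/andP; split; lra.
Qed.

(** A monotone operator that commutes with the addition of constants is
    nonexpansive for the sup norm; if it moreover preserves the [K]-Lipschitz
    functions of a compact space, it has an additive eigenfunction. *)
Section TopicalEigenproblem.
Variables (R : realType) (T : metricType R) (x0 : T) (K : R).
Variable S : (T -> R) -> T -> R.
Hypothesis cT : compact [set: T].
Hypothesis diam1 : forall x y : T, mdist x y <= 1 :> R.
Hypothesis K0 : 0 <= K.
Hypothesis S_klip : forall u, klip K u -> klip K (S u).
Hypothesis S_le : forall u v, klip K u -> klip K v ->
  (forall x, u x <= v x) -> forall x, S u x <= S v x.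
Hypothesis S_add : forall u c, klip K u ->
  forall x, S (fun y => u y + c) x = S u x + c.

Implicit Types (u v g : T -> R) (c : R).

Lemma klip_add u c : klip K u -> klip K (fun y => u y + c).
Proof. by move=> uK x y; have := uK x y; lra. Qed.

Lemma klip_osc u x y : klip K u -> u x - u y <= K.
Proof. by move=> uK; apply: le_trans (uK x y) _; rewrite ler_piMr. Qed.

Lemma topical_le_add u v c : klip K u -> klip K v ->
  (forall x, u x <= v x + c) -> forall x, S u x <= S v x + c.
Proof. by move=> uK vK uv x; rewrite -S_add//; apply: S_le => //; exact: klip_add. Qed.

Let zero : T -> R := fun=> 0.

Lemma klip_iter_topical u n : klip K u -> klip K (iter n S u).
Proof. by move=> uK; elim: n => //= n IH; exact: S_klip. Qed.

Lemma iter_topical_le_add u v c n : klip K u -> klip K v ->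
  (forall x, u x <= v x + c) -> forall x, iter n S u x <= iter n S v x + c.
Proof.
move=> uK vK uv; elim: n => //= n IH.
by apply: topical_le_add => //; exact: klip_iter_topical.
Qed.

Let klip0 : klip K zero.
Proof. by move=> x y; rewrite subrr mulr_ge0 ?mdist_ge0. Qed.

(** A [K]-Lipschitz iterate oscillates by at most [K], so the values of the
    iterates at one point are additive up to [K]. *)
Lemma topical_growth_rate :
  exists c, forall n x, `|iter n S zero x - n%:R * c| <= 2 * K.
Proof.
have [m n|c hc] := @quasi_additive_slope _ K (fun n => iter n S zero x0).
  have mnE : iter (m + n) S zero x0 = iter m S (iter n S zero) x0.
    by rewrite iterD.
  rewrite mnE ler_norml; apply/andP; split.
    have h x : zero x <= iter n S zero x + (K - iter n S zero x0).
      by have := klip_osc x0 x (klip_iter_topical n klip0); rewrite /zero; lra.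
    have := iter_topical_le_add m klip0 (klip_iter_topical n klip0) h x0; lra.
  have h x : iter n S zero x <= zero x + (K + iter n S zero x0).
    by have := klip_osc x x0 (klip_iter_topical n klip0); rewrite /zero; lra.
  have := iter_topical_le_add m (klip_iter_topical n klip0) klip0 h x0; lra.
exists c => n x; have := hc n.
have := klip_osc x x0 (klip_iter_topical n klip0).
have := klip_osc x0 x (klip_iter_topical n klip0).
by rewrite !ler_norml => ? ? /andP[? ?]; apply/andP; split; lra.
Qed.

Lemma topical_cvg (F : nat -> T -> R) f : (forall n, klip K (F n)) ->
    (forall x, F n x @[n --> \oo] --> f x) ->
  klip K f /\ forall x, S (F n) x @[n --> \oo] --> S f x.
Proof.
move=> FK Ff; have [fK unif] := klip_cvg_uniform cT FK Ff; split=> // x.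
apply/cvgrPdist_lt => e e0; have e2 : 0 < e / 2 by rewrite divr_gt0.
have := unif _ e2; apply: filterS => n Fn.
have h1 : S (F n) x <= S f x + e / 2.
  apply: topical_le_add => // y.
  by have := Fn y; rewrite ltr_norml => /andP[? ?]; lra.
have h2 : S f x <= S (F n) x + e / 2.
  apply: topical_le_add => // y.
  by have := Fn y; rewrite ltr_norml => /andP[? ?]; lra.
by rewrite ltr_norml; apply/andP; split; lra.
Qed.

(** The pointwise limsup of the normalised iterates is a subsolution:
    monotonicity of [S] gives the inequality between tail suprema, and
    continuity of [S] carries it to their decreasing limit. *)
Lemma topical_subsolution : exists c g, [/\ klip K g,
  forall x, g x + c <= S g x,
  forall x, g x <= 2 * K &
  forall n x, `|iter n S zero x - n%:R * c| <= 2 * K].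
Proof.
have [c hc] := topical_growth_rate; exists c.
pose w n x := iter n S zero x - n%:R * c.
have wB n x : - (2 * K) <= w n x <= 2 * K by rewrite -ler_norml; exact: hc.
have wK n : klip K (w n) by apply: klip_add; exact: klip_iter_topical.
have wS n x : w n.+1 x = S (w n) x - c.
  by rewrite /w S_add ?iterS -?natr1; [ring|exact: klip_iter_topical].
pose E n x := [set w k x | k in [set k | (n <= k)%N]].
have supE n x : has_sup (E n x).
  split; first by exists (w n x); exists n => /=.
  by exists (2 * K) => _ [k _ <-]; have /andP[] := wB k x.
pose F n x := sup (E n x).
have wF n k x : (n <= k)%N -> w k x <= F n x.
  by move=> nk; apply: ub_le_sup; [case: (supE n x)|exists k].
have FM n x M : (forall k, (n <= k)%N -> w k x <= M) -> F n x <= M.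
  move=> h; apply: ge_sup; first by case: (supE n x).
  by move=> _ [k nk <-]; exact: h.
have FK n : klip K (F n).
  move=> x y; rewrite lerBlDr; apply: FM => k nk.
  by have := wK k x y; have := wF n k y nk; lra.
have Fnon x : nonincreasing_seq (F^~ x).
  by move=> m n mn; apply: FM => k nk; apply: wF; exact: leq_trans nk.
have Fcvg x : cvgn (F^~ x).
  apply: nonincreasing_is_cvgn => //; exists (- (2 * K)) => _ [n _ <-].
  by apply: le_trans (wF n n x (leqnn n)); have /andP[] := wB n x.
pose g x := limn (F^~ x).
have gF n x : g x <= F n x by apply: nonincreasing_cvgn_ge.
have [gK Sg] := @topical_cvg F g FK Fcvg.
exists g; split => //; last first.
  move=> x; apply: le_trans (gF 0%N x) _; apply: FM => k _.
  by have /andP[] := wB k x.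
move=> x; rewrite -lerBrDr -(cvg_lim _ (cvgB (Sg x) (cvg_cst c)))//.
apply: limr_ge; first by apply/cvg_ex; exists (S g x - c); apply: cvgB => //; exact: cvg_cst.
near=> n; apply: le_trans (gF n.+1 x) _; apply: FM => -[//|k] nk.
rewrite wS lerB//; apply: S_le => // y; exact: wF.
Unshelve. all: by end_near. Qed.

(** Iterating from a subsolution gives an increasing sequence, bounded because
    the subsolution lies below a translate of the initial constant. *)
Theorem topical_eigenproblem :
  exists u c, klip K u /\ forall x, S u x = u x + c.
Proof.
have [c [g [gK gS gB hc]]] := topical_subsolution.
pose v n x := iter n S g x - n%:R * c.
have vK n : klip K (v n) by apply: klip_add; exact: klip_iter_topical.
have vS n x : v n.+1 x = S (v n) x - c.
  by rewrite /v S_add ?iterS -?natr1; [ring|exact: klip_iter_topical].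
have vB n x : v n x <= 4 * K.
  have h y : g y <= zero y + 2 * K by rewrite add0r.
  have := iter_topical_le_add n gK klip0 h x.
  by have := hc n x; rewrite ler_norml /v => /andP[_]; lra.
have vnon x : nondecreasing_seq (v^~ x).
  apply/nondecreasing_seqP => n; elim: n x => [|n IH] x.
    by rewrite vS /v mul0r subr0 lerBrDr; have := gS x;
      rewrite (_ : (fun=> _) = g)//; apply/funext => y; rewrite subr0.
  by rewrite !vS lerB//; exact: S_le.
have vcvg x : cvgn (v^~ x).
  by apply: nondecreasing_is_cvgn => //; exists (4 * K) => _ [n _ <-].
pose u x := limn (v^~ x).
have [uK Su] := @topical_cvg v u vK vcvg.
exists u, c; split => // x.
have h1 : v n.+1 x @[n --> \oo] --> u x by rewrite (cvg_shiftS (v^~ x)); exact: vcvg.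
have h2 : v n.+1 x @[n --> \oo] --> S u x - c.
  by under eq_fun do rewrite vS; apply: cvgB => //; exact: cvg_cst.
by rewrite -(cvg_lim _ h1)// (cvg_lim _ h2)// subrK.
Qed.

End TopicalEigenproblem.

(** * Integration of continuous functions on the circle *)

Lemma probability_integral_cst d (T : measurableType d) (R : realType)
  (P : probability T R) c : \int[P]_x c = c.
Proof. by rewrite Rintegral_cst//= probability_setT mulr1. Qed.

Section BorelIntegral.
Variables (R : realType) (T : ptopologicalType).

Lemma continuous_borel_measurable (f : T -> R) :
  continuous f -> measurable_fun [set: borel T] f.
Proof.
move=> /continuousP cf; apply: (measurability _ (RGenOpens.measurableE R)).
move=> _ [_ [a [b ->] <-]]; rewrite setTI; apply: sub_sigma_algebra.
by apply: cf; exact: interval_open.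
Qed.

Lemma continuous_borel_integrable (P : probability (borel T) R) (f : T -> R) (M : R) :
  continuous f -> (forall x, `|f x| <= M) -> P.-integrable setT (EFin \o f).
Proof.
move=> cf fM; apply: measurable_bounded_integrable => //.
- by apply: le_lt_trans (probability_le1 P measurableT) (ltry 1).
- exact: continuous_borel_measurable.
- exists M; split; first exact: num_real.
  by move=> x Mx y _; apply: le_trans (fM y) (ltW Mx).
Qed.

End BorelIntegral.

Section CircleIntegral.
Variable R : realType.
Implicit Types f g : circle R -> R.

Lemma compact_circle : compact [set: circle R].
Proof.
have -> : [set: circle R] = @circle_of R @` `[0, 1]%classic.
  apply/seteqP; split => // x _; exists (circle_val x).
    by rewrite /= in_itv /=; have /andP[-> /ltW ->] := circle_itv x.
  exact: circle_ofK.
apply: (@continuous_compact R (circle R)); last exact: segment_compact.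
apply: continuous_subspaceT => t U /(@nbhs_ballP R (circle R))[e /= e0 eU].
apply/nbhs_ballP; exists e => //= s ts; apply: eU; rewrite ballEmdist /=.
exact: le_lt_trans (circle_of_lipschitz t s) ts.
Qed.

Lemma circle_integrable f : continuous f ->
  (@circle_leb R).-integrable setT (EFin \o f).
Proof.
move=> cf; have [M fM] := compact_bounded_fun compact_circle cf.
exact: continuous_borel_integrable fM.
Qed.

Lemma le_circle_integral f g : continuous f -> continuous g ->
  (forall a, f a <= g a) ->
  \int[@circle_leb R]_a f a <= \int[@circle_leb R]_a g a.
Proof.
by move=> cf cg fg; apply: le_Rintegral => //; exact: circle_integrable.
Qed.

Lemma circle_integralD f g : continuous f -> continuous g ->
  \int[@circle_leb R]_a (f a + g a) =
  \int[@circle_leb R]_a f a + \int[@circle_leb R]_a g a.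
Proof. by move=> cf cg; rewrite RintegralD//; exact: circle_integrable. Qed.

Lemma circle_integralZ f c : continuous f ->
  \int[@circle_leb R]_a (c * f a) = c * \int[@circle_leb R]_a f a.
Proof. by move=> cf; rewrite RintegralZl//; exact: circle_integrable. Qed.

Lemma circle_integral_cst c : \int[@circle_leb R]_a c = c.
Proof. exact: probability_integral_cst. Qed.

(** One of the two arcs of length [d] issued from [a0] lifts to a segment
    inside [0, 1]. *)
Lemma circle_integral_arc f (a0 : circle R) (m d : R) :
    continuous f -> (forall a, 0 <= f a) ->
    0 < d <= 2^-1 -> 0 <= m -> (forall a, mdist a0 a <= d -> m <= f a) ->
  m * d <= \int[@circle_leb R]_a f a.
Proof.
move=> cf f0 /andP[d0 d2] m0 fm.
have /andP[v0 v1] := circle_itv a0; set t0 := circle_val a0 in v0 v1.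
have [s /and3P[s0 s1 sd]] : exists s : R, [&& 0 <= s, s + d <= 1 &
    (s == t0) || (s + d == t0)].
  have [t2|t2] := leP t0 2^-1.
    by exists t0; rewrite v0 eqxx /= andbT; lra.
  by exists (t0 - d); rewrite subrK eqxx orbT andbT; apply/andP; split; lra.
have mf : measurable_fun [set: borel (circle R)] (EFin \o f).
  by apply/measurable_EFinP; exact: continuous_borel_measurable.
have mfr : measurable_fun [set: measurableTypeR R] (EFin \o f \o @circle_rv R).
  by apply: measurableT_comp mf _; exact: measurable_circle_rv.
have fin : (\int[@circle_leb R]_a (f a)%:E)%E \is a fin_num.
  exact: integrable_fin_num (circle_integrable cf).
rewrite -lee_fin /Rintegral fineK//.
have -> : (\int[@circle_leb R]_a (f a)%:E =
    \int[uniform_prob (@ltr01 R)]_t (EFin \o f \o @circle_rv R) t)%E.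
  rewrite /circle_leb ge0_integral_pushforward// => a _; rewrite lee_fin; exact: f0.
rewrite integral_uniform//; last by move=> t; rewrite lee_fin; exact: f0.
rewrite subr0 invr1 mul1e.
apply: (@le_trans _ _ (\int[lebesgue_measure]_(t in `[s, (s + d)%R]) m%:E)%E).
  rewrite integral_cst//= lebesgue_measure_itv /= lte_fin ltrDl d0.
  by rewrite -EFinD -EFinM addrAC subrr add0r.
apply: (@le_trans _ _ (\int[lebesgue_measure]_(t in `[s, (s + d)%R])
   (EFin \o f \o @circle_rv R) t)%E).
  apply: ge0_le_integral => //=.
  - exact: measurable_funTS.
  - move=> t; rewrite in_itv /= => /andP[st ts]; rewrite lee_fin; apply: fm.
    rewrite -[a0]circle_ofK; apply: le_trans (circle_of_lipschitz _ _) _.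
    rewrite -/t0 ler_norml; apply/andP.
    by move/orP: sd => -[/eqP <-|/eqP <-]; split; lra.
apply: ge0_subset_integral => //=.
- exact: measurable_funTS.
- by move=> t _; rewrite lee_fin; exact: f0.
- by move=> t /=; rewrite !in_itv /= => /andP[? ?]; apply/andP; split; lra.
Qed.

End CircleIntegral.

(** * The equation on preimages: maximum and log-integral *)

Section TransferEigenproblem.
Variable R : realType.
Implicit Types (f g : circle R -> R) (u A : seqspace R -> R) (x y : seqspace R).
Implicit Types (c K : R).

(** A fibrewise functional of this kind turns into an operator on functions of
    sequences: apply it to the values of [A + u] on the preimages of a point.
    The supremum gives the operator of the subaction equation, and the
    logarithm of the integral of the exponential the logarithmic form of the
    Ruelle operator. *)
Definition topical (Phi : (circle R -> R) -> R) :=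
  (forall f g, continuous f -> continuous g ->
    (forall a, f a <= g a) -> Phi f <= Phi g) /\
  (forall f c, continuous f -> Phi (fun a => f a + c) = Phi f + c).

Definition fibre u x : circle R -> R := fun a => u (prepend a x).

Lemma klip_fibre K u x : klip K u -> klip K (fibre u x).
Proof. by move=> uK a b; have := uK (prepend a x) (prepend b x); rewrite mdist_prepend1. Qed.

Lemma klipD (T : metricType R) K L (u v : T -> R) : klip K u -> klip L v ->
  klip (K + L) (fun t => u t + v t).
Proof. by move=> uK vL s t; have := uK s t; have := vL s t; rewrite mulrDl; lra. Qed.

Lemma continuousDc (T : topologicalType) (f : T -> R) c :
  continuous f -> continuous (fun a => f a + c).
Proof. by move=> cf a; apply: cvgD; [exact: cf | exact: cvg_cst]. Qed.

Lemma continuousDf (T : topologicalType) (f g : T -> R) :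
  continuous f -> continuous g -> continuous (fun a => f a + g a).
Proof. by move=> cf cg a; apply: cvgD; [exact: cf | exact: cg]. Qed.

Lemma continuousBf (T : topologicalType) (f g : T -> R) :
  continuous f -> continuous g -> continuous (fun a => f a - g a).
Proof. by move=> cf cg a; apply: cvgB; [exact: cf | exact: cg]. Qed.

Lemma continuousMf (T : topologicalType) (f g : T -> R) :
  continuous f -> continuous g -> continuous (fun a => f a * g a).
Proof. by move=> cf cg a; apply: cvgM; [exact: cf | exact: cg]. Qed.

Lemma continuousZc (T : topologicalType) (f : T -> R) c :
  continuous f -> continuous (fun a => c * f a).
Proof. by move=> cf a; apply: cvgMr; exact: cf. Qed.

(** Prepending a letter halves distances, so on fibres the [2 * K]-Lipschitz
    function [A + u] is [K]-Lipschitz in the base point. *)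
Theorem transfer_eigenproblem Phi A K : topical Phi -> 0 <= K -> klip K A ->
  exists u c, klip K u /\
    forall x, Phi (fibre (fun z => A z + u z) x) = u x + c.
Proof.
move=> [Phi_le Phi_add] K0 AK.
pose S u x := Phi (fibre (fun z => A z + u z) x).
have cS u x : klip K u -> continuous (fibre (fun z => A z + u z) x).
  by move=> uK; apply: (@klip_continuous _ _ (K + K)); apply/klip_fibre/klipD.
apply: (@topical_eigenproblem R (seqspace R) point K S) => //.
- exact: compact_seqspace.
- exact: seq_dist_le1.
- move=> u uK x y; rewrite lerBlDl /S -Phi_add; last exact: cS.
  apply: Phi_le; first exact: cS.
    exact/continuousDc/cS.
  move=> a; have := klipD AK uK (prepend a x) (prepend a y).
  by rewrite mdist_prepend2 /fibre; lra.
- move=> u v uK vK uv x; apply: Phi_le; [exact: cS..|].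
  by move=> a; rewrite /fibre lerD2l.
- move=> u c uK x; rewrite /S -Phi_add; last exact: cS.
  by congr Phi; apply/funext => a; rewrite /fibre addrA.
Qed.

Definition circle_max f := sup (range f).

Lemma circle_maxP f : continuous f -> exists2 a, circle_max f = f a &
  forall b, f b <= f a.
Proof.
move=> cf; have [| a _ fa] := compact_EVT_max _ (@compact_circle R)
    (continuous_subspaceT cf); first by exists point.
exists a => [|b]; last by apply: fa; rewrite inE.
have faS : ubound (range f) (f a) by move=> _ [b _ <-]; apply: fa; rewrite inE.
apply/le_anti/andP; split; first by apply: ge_sup => //; exists (f a); exists a.
by apply: ub_le_sup; [exists (f a) | exists a].
Qed.

Lemma topical_circle_max : topical circle_max.
Proof.
split=> [f g cf cg fg | f c cf].
  have [a -> _] := circle_maxP cf; have [b -> gb] := circle_maxP cg.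
  exact: le_trans (fg a) (gb a).
have cfc := continuousDc (c := c) cf.
have [a -> fa] := circle_maxP cf; have [b -> gb] := circle_maxP cfc.
by apply/le_anti; have := fa b; have := gb a; move=> ? ?; apply/andP; split; lra.
Qed.

Definition circle_logint f := ln (\int[@circle_leb R]_a expR (f a)).

Lemma continuous_expR_comp (T : topologicalType) (f : T -> R) :
  continuous f -> continuous (fun a => expR (f a)).
Proof. by move=> cf a; apply: (continuous_comp (cf a)); exact: continuous_expR. Qed.

Lemma circle_int_expR_gt0 f : continuous f ->
  0 < \int[@circle_leb R]_a expR (f a).
Proof.
move=> cf; have [M fM] := compact_bounded_fun (@compact_circle R) cf.
apply: (@lt_le_trans _ _ (expR (- M))); first exact: expR_gt0.
rewrite -(circle_integral_cst (expR (- M))); apply: le_circle_integral.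
- exact: cst_continuous.
- exact: continuous_expR_comp.
- by move=> a; rewrite ler_expR; have := fM a; rewrite ler_norml => /andP[].
Qed.

Lemma expR_circle_logint f : continuous f ->
  expR (circle_logint f) = \int[@circle_leb R]_a expR (f a).
Proof. by move=> cf; rewrite lnK// posrE circle_int_expR_gt0. Qed.

Lemma topical_circle_logint : topical circle_logint.
Proof.
split=> [f g cf cg fg | f c cf].
  rewrite -ler_expR !expR_circle_logint//.
  apply: le_circle_integral; [exact: continuous_expR_comp..|].
  by move=> a; rewrite ler_expR.
apply: expR_inj; rewrite expRD !expR_circle_logint//; last first.
  exact: continuousDc.
rewrite mulrC -circle_integralZ; last exact: continuous_expR_comp.
by apply: eq_Rintegral => a _; rewrite expRD mulrC.
Qed.

Lemma circle_logint_le f M : continuous f -> (forall a, f a <= M) ->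
  circle_logint f <= M.
Proof.
move=> cf fM; rewrite -ler_expR expR_circle_logint//.
rewrite -[leRHS]circle_integral_cst; apply: le_circle_integral.
- exact: continuous_expR_comp.
- exact: cst_continuous.
- by move=> a; rewrite ler_expR.
Qed.

(** Laplace's principle, quantitatively: an arc of length [d] carries mass [d],
    and on the points at distance at most [d] from [a0] the function drops by
    at most [K * d]. *)
Lemma circle_logint_ge f a0 K (d : R) : continuous f -> 0 <= K -> klip K f ->
  0 < d <= 2^-1 -> f a0 - K * d + ln d <= circle_logint f.
Proof.
move=> cf K0 fK d02; have /andP[d0 _] := d02.
rewrite -ler_expR expR_circle_logint// expRD lnK//.
apply: (circle_integral_arc (a0 := a0)) => //.
- exact: continuous_expR_comp.
- move=> a a0a; rewrite ler_expR lerBlDr; have := fK a0 a.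
  by have := ler_wpM2l K0 a0a; lra.
Qed.

End TransferEigenproblem.

(** * Invariant measures on periodic orbits *)

Section PeriodicMeasures.
Variable R : realType.
Implicit Types (u A : seqspace R -> R) (x y p : seqspace R) (c K : R).

Lemma continuous_seq_shift : continuous (@seq_shift R).
Proof.
move=> x U /(@nbhs_ballP R (seqspace R))[e /= e0 eU].
apply/(@nbhs_ballP R (seqspace R)); exists (e / 2); first by rewrite /= divr_gt0.
move=> y; rewrite ballEmdist /= => xy; apply: eU; rewrite ballEmdist /=.
by have := mdist_ge0 (x 0%N) (y 0%N); have := seq_dist_rec x y; lra.
Qed.

Lemma measurable_seq_shift :
  measurable_fun [set: borel (seqspace R)] (@seq_shift R : _ -> borel (seqspace R)).
Proof.
apply: (@measurability _ _ (borel (seqspace R)) (borel (seqspace R)) setT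
  (@seq_shift R) (@open (seqspace R)) erefl).
move=> _ [U oU <-]; rewrite setTI; apply: sub_sigma_algebra.
by move/continuousP: continuous_seq_shift; exact.
Qed.

Lemma seqspace_integrable (mu : probability (borel (seqspace R)) R) A :
  continuous A -> mu.-integrable setT (EFin \o A).
Proof.
move=> cA; have [M AM] := compact_bounded_fun (@compact_seqspace R) cA.
exact: continuous_borel_integrable AM.
Qed.

Lemma shift_invariant_integral (mu : probability (borel (seqspace R)) R) A :
    shift_invariant mu -> continuous A ->
  \int[mu]_x A (seq_shift x) = \int[mu]_x A x.
Proof.
move=> mu_inv cA; congr fine.
have cAs : continuous (A \o @seq_shift R).
  by move=> x; apply: continuous_comp; [exact: continuous_seq_shift | exact: cA].
have := @integral_pushforward _ _ _ _ R _ measurable_seq_shift mu setT (EFin \o A).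
rewrite preimage_setT => <- //.
- apply: eq_measure_integral => [|mshift E mE _]; first exact: measurable_seq_shift.
  exact: mu_inv.
- by apply/measurable_EFinP; exact: continuous_borel_measurable.
- exact: (seqspace_integrable mu cAs).
Qed.

Let orbit_measure p n : {measure set (borel (seqspace R)) -> \bar R} :=
  msum (fun j => \d_(iter j (@seq_shift R) p : borel (seqspace R))) n.

Lemma periodic_measure p n : iter n.+1 (@seq_shift R) p = p ->
  exists mu : probability (borel (seqspace R)) R, shift_invariant mu /\
    forall A, continuous A ->
      \int[mu]_x A x = (\sum_(j < n.+1) A (iter j (@seq_shift R) p)) / n.+1%:R.
Proof.
move=> pn.
pose nu := orbit_measure p n.+1.
have nuE E : nu E = (\sum_(j < n.+1) (iter j (@seq_shift R) p \in E)%:R)%:E.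
  rewrite /nu /= /msum -sumEFin; apply: eq_bigr => j _; exact: diracE.
have nuT : nu setT = n.+1%:R%:E.
  rewrite nuE; under eq_bigr do rewrite in_setT /=.
  by rewrite sumr_const card_ord.
(* the point mass is a default, for measures of total mass 0 or +oo *)
pose mu : probability (borel (seqspace R)) R :=
  mnormalize nu (\d_(p : borel (seqspace R))).
have muE E : mu E = ((n.+1%:R^-1)%:E * nu E)%E.
  rewrite /mu /= /mnormalize nuT eqe pnatr_eq0 /= muleC.
  by [].
exists mu; split.
  move=> E mE; rewrite !muE !nuE; congr (_ * _%:E)%E.
  (* the shifted orbit is the orbit with its first point moved to the end *)
  rewrite [RHS]big_ord_recl [LHS]big_ord_recr /= addrC; congr (_ + _).
  by rewrite /= -[X in (X \in E)]pn.
move=> A cA.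
have [M AM] := compact_bounded_fun (@compact_seqspace R) cA.
have cAM : continuous (fun x => A x + M) by exact: continuousDc.
(* the integral of a sum of measures is computed on nonnegative functions *)
have AM0 x : 0 <= A x + M by have := AM x; rewrite ler_norml; lra.
have : \int[mu]_x (A x + M) = \int[mu]_x A x + M.
  rewrite RintegralD//; first by rewrite probability_integral_cst.
    exact: seqspace_integrable.
  by apply: (seqspace_integrable mu); exact: cst_continuous.
suff -> : \int[mu]_x (A x + M) =
    (\sum_(j < n.+1) (A (iter j (@seq_shift R) p) + M)) / n.+1%:R.
  rewrite big_split /= sumr_const card_ord mulrDl -(mulr_natr M).
  by rewrite mulfK ?pnatr_eq0// => /addIr ->.
have mAM : measurable_fun [set: borel (seqspace R)] (fun x => (A x + M)%:E).
  by apply/measurable_EFinP; exact: continuous_borel_measurable.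
have n0 : 0 <= (n.+1%:R^-1 : R) by rewrite invr_ge0.
rewrite /Rintegral (@eq_measure_integral _ _ _ _ (mscale (NngNum n0) nu)); last first.
  by move=> E mE _; exact: muE.
rewrite ge0_integral_mscale//; last by move=> x _; rewrite lee_fin.
rewrite ge0_integral_measure_sum//; last by move=> x _; rewrite lee_fin.
under eq_bigr do rewrite integral_dirac// diracT mul1e.
by rewrite sumEFin /= mulrC.
Qed.

End PeriodicMeasures.

(** * The constant of a subaction is the maximal integral *)

Section MaxIntegral.
Variable R : realType.
Variables (A u : seqspace R -> R) (c K : R).
Hypotheses (K0 : 0 <= K) (AK : klip K A) (uK : klip K u).
Hypothesis Au : forall x, circle_max (fibre (fun z => A z + u z) x) = u x + c.

Let cA : continuous A. Proof. exact: klip_continuous AK. Qed.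
Let cu : continuous u. Proof. exact: klip_continuous uK. Qed.
Let cfib x : continuous (fibre (fun z => A z + u z) x).
Proof. by apply: (@klip_continuous _ _ (K + K)); apply/klip_fibre/klipD. Qed.

Lemma subaction_le x : A x + u x <= u (seq_shift x) + c.
Proof.
rewrite -Au; have [a -> amax] := circle_maxP (@cfib (seq_shift x)).
by have := amax (x 0%N); rewrite /fibre prepend_seq_shift.
Qed.

Lemma subaction_backward_step y :
  exists x, seq_shift x = y /\ A x + u x = u y + c.
Proof.
have [a amax _] := circle_maxP (@cfib y).
by exists (prepend a y); split=> //; rewrite -Au amax.
Qed.

(** Integrate [subaction_le]: the two integrals of [u] cancel by invariance. *)
Lemma invariant_integral_le (mu : probability (borel (seqspace R)) R) :
  shift_invariant mu -> \int[mu]_x A x <= c.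
Proof.
move=> mu_inv.
have cus : continuous (fun x => u (seq_shift x)).
  by move=> x; apply: continuous_comp; [exact: continuous_seq_shift | exact: cu].
have cAu : continuous (fun x => A x + u x) by exact: continuousDf.
have : \int[mu]_x (A x + u x) <= \int[mu]_x (u (seq_shift x) + c).
  apply: le_Rintegral => //; [exact: seqspace_integrable| |].
    by apply: seqspace_integrable; exact: continuousDc.
  by move=> x _; exact: subaction_le.
rewrite RintegralD//; [|exact: seqspace_integrable..].
rewrite RintegralD//; [|exact: seqspace_integrable|]; last first.
  by apply: (seqspace_integrable mu); exact: cst_continuous.
by rewrite probability_integral_cst shift_invariant_integral// addrC lerD2l.
Qed.

Lemma iter_seq_shift (x : seqspace R) j i : iter j (@seq_shift R) x i = x (j + i)%N.
Proof. by elim: j i => // j IH i; rewrite iterS {1}/seq_shift IH addnS. Qed.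

(** Following maximising preimages backwards from any point for [N] steps
    gives a Birkhoff sum [N * c] up to a bounded error; since the shift is full,
    the [N] letters read off can be repeated periodically, and the geometric
    contraction of the inverse branches keeps the error bounded. *)
Lemma exists_periodic_almost_maximal N : exists p : seqspace R,
  iter N.+1 (@seq_shift R) p = p /\
  N.+1%:R * c - 2 * K <= \sum_(j < N.+1) A (iter j (@seq_shift R) p).
Proof.
have [step stepP] := choice subaction_backward_step.
pose Y k := iter k step point.
have YS k : A (Y k.+1) = u (Y k) + c - u (Y k.+1).
  by have [_ <-] := stepP (Y k); rewrite addrK.
have shiftY j k : iter j (@seq_shift R) (Y (j + k)%N) = Y k.
  elim: j k => // j IH k; rewrite iterSr addSn.
  by have [-> _] := stepP (Y (j + k)%N); exact: IH.
pose p : seqspace R := fun i => Y N.+1 (i %% N.+1)%N.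
exists p; split.
  by apply/funext => i; rewrite iter_seq_shift /p modnDl.
(* the error at time N.+1 - k is at most K / 2 ^ k; B absorbs it *)
pose B k := A (Y k) - K * 2^-1 ^+ k.
have AB (j : 'I_N.+1) : B (N.+1 - j)%N <= A (iter j (@seq_shift R) p).
  have := AK (Y (N.+1 - j)%N) (iter j (@seq_shift R) p).
  suff /(ler_wpM2l K0) : mdist (Y (N.+1 - j)%N) (iter j (@seq_shift R) p) <=
    2^-1 ^+ (N.+1 - j) by rewrite /B; lra.
  apply: seq_dist_agree => i; rewrite ltn_subRL => ji.
  rewrite iter_seq_shift /p modn_small// -iter_seq_shift.
  by rewrite -(shiftY j) subnKC // ltnW.
have sumB m : \sum_(k < m) B k.+1 =
    m%:R * c + u (Y 0%N) - u (Y m) - K * (1 - 2^-1 ^+ m).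
  elim: m => [|m IH]; first by rewrite big_ord0 expr0; ring.
  by rewrite big_ord_recr /= IH /B YS -natr1 exprSr; field.
apply: (@le_trans _ _ (\sum_(j < N.+1) B (N.+1 - j)%N)); last first.
  by apply: ler_sum => j _; exact: AB.
rewrite (reindex_inj rev_ord_inj) /=.
under eq_bigr => j _ do rewrite subKn//.
rewrite sumB; have := klip_osc (@seq_dist_le1 R) K0 (Y N.+1) (Y 0%N) uK.
have : 0 <= K * 2^-1 ^+ N.+1 by rewrite mulr_ge0// exprn_ge0.
lra.
Qed.

(** The supremum over invariant measures is already approached by periodic
    orbits, with an error of order 1 / n for orbits of length n. *)
Theorem max_integralE : max_integral A = c.
Proof.
have ubc : ubound [set \int[mu]_x A x | mu in @shift_invariant R] c.
  by move=> _ [mu mu_inv <-]; exact: invariant_integral_le.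
have lo N : c - 2 * K / N.+1%:R <= max_integral A.
  have [p [pN pA]] := exists_periodic_almost_maximal N.
  have [mu [mu_inv muA]] := periodic_measure pN.
  apply: (@le_trans _ _ (\int[mu]_x A x)).
    by rewrite muA// ler_pdivlMr ?ltr0n// mulrBl divfK ?pnatr_eq0// mulrC.
  by apply: ub_le_sup; [exists c | exists mu].
apply/le_anti/andP; split.
  have [p [pN _]] := exists_periodic_almost_maximal 0.
  have [mu [mu_inv _]] := periodic_measure pN.
  by apply: ge_sup => //; exists (\int[mu]_x A x); exists mu.
apply/ler_addgt0Pr => e e0.
pose N := Num.truncn (2 * K / e).
rewrite -lerBlDr; apply: le_trans (lo N); rewrite lerD2l lerN2.
rewrite ler_pdivrMr ?ltr0n// (mulrC e) -ler_pdivrMr// ltW//.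
exact: truncnS_gt.
Qed.

Lemma calibrated_of_eigenproblem : calibrated_subaction A u.
Proof.
split; first exact: cu.
move=> y; rewrite max_integralE; split.
  by have [x [xy Aux]] := subaction_backward_step y; exists x; rewrite // Aux addrK.
by move=> _ [x <- <-]; have := subaction_le x; lra.
Qed.

End MaxIntegral.

(** * Geometric convergence and complex moduli *)

Section GeometricConvergence.
Variable R : realType.
Implicit Types (C r : R).

Lemma cvg_geometric0 C r : 0 <= r < 1 -> C * r ^+ n @[n --> \oo] --> 0.
Proof.
move=> /andP[r0 r1]; rewrite -[X in _ --> X](mulr0 C); apply: cvgMr.
by apply: cvg_expr; rewrite ger0_norm.
Qed.

Lemma le_geometric_eq0 (a C r : R) : 0 <= r < 1 ->
  (forall n, a <= C * r ^+ n) -> a <= 0.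
Proof.
move=> r01 h; have cv := cvg_geometric0 C r01; rewrite -(cvg_lim _ cv)//.
by apply: limr_ge; [apply/cvg_ex; exists 0 | exact: nearW].
Qed.

Lemma geometric_cvg (T : Type) (F : nat -> T -> R) C r : 0 <= r < 1 ->
    (forall n x, `|F n.+1 x - F n x| <= C * r ^+ n) ->
  exists f, forall n x, `|f x - F n x| <= C / (1 - r) * r ^+ n.
Proof.
move=> r01 FC; have /andP[r0 r1] := r01.
have r1' : 0 < 1 - r by rewrite subr_gt0.
have FB n m x : `|F (n + m)%N x - F n x| <= C / (1 - r) * r ^+ n * (1 - r ^+ m).
  elim: m => [|m IH]; first by rewrite addn0 subrr normr0 expr0 subrr mulr0.
  have -> : F (n + m.+1)%N x - F n x =
     (F (n + m).+1 x - F (n + m)%N x) + (F (n + m)%N x - F n x).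
    by rewrite addnS; ring.
  apply: le_trans (ler_normD _ _) _; apply: le_trans (lerD (FC _ _) IH) _.
  rewrite exprD exprSr le_eqVlt; apply/orP; left; apply/eqP; field.
  by rewrite gt_eqF.
have Fcvg x : cvgn (F^~ x).
  have -> : F^~ x = (fun n => F 0%N x + series (fun k => F k.+1 x - F k x) n).
    by apply/funext => n; rewrite seriesEnat /= telescope_sumr// addrC subrK.
  apply: is_cvgD; first exact: is_cvg_cst.
  apply: normed_cvg; apply: (@series_le_cvg _ _ (geometric C r)).
  - by move=> n; exact: normr_ge0.
  - by move=> n; apply: le_trans (FC n x).
  - by move=> n; exact: FC.
  - by apply: is_cvg_geometric_series; rewrite ger0_norm.
exists (fun x => limn (F^~ x)) => n x.
have h : `|F (m + n)%N x - F n x| @[m --> \oo] --> `|limn (F^~ x) - F n x|.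
  apply: cvg_norm; apply: cvgB; last exact: cvg_cst.
  by rewrite (cvg_shiftn n (F^~ x)); exact: Fcvg.
rewrite -(cvg_lim _ h)//; apply: limr_le; first by apply/cvg_ex; eexists; exact: h.
apply: nearW => m; rewrite addnC; apply: le_trans (FB n m x) _.
rewrite ler_piMr//; last by rewrite lerBlDl lerDr exprn_ge0.
by have := le_trans (normr_ge0 _) (FC 0%N x); rewrite expr0 mulr1 => C0;
  rewrite mulr_ge0 ?exprn_ge0// divr_ge0// ltW.
Qed.

Lemma geometric_limit_continuous (T : topologicalType) (F : nat -> T -> R) f C r :
    0 <= r < 1 -> (forall n, continuous (F n)) ->
    (forall n x, `|f x - F n x| <= C * r ^+ n) -> continuous f.
Proof.
move=> r01 cF fF x; apply/cvgrPdist_lt => e e0.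
have e3 : 0 < e / 3 by rewrite divr_gt0.
have /cvgrPdist_lt/(_ _ e3)[n _ /(_ n (leqnn n))/= hn] := cvg_geometric0 C r01.
have {}hn : C * r ^+ n < e / 3.
  by rewrite (le_lt_trans (ler_norm _))// -normrN -sub0r.
have /cvgrPdist_lt/(_ _ e3) := cF n x; apply: filterS => y Fxy.
have fx := fF n x; have fy := fF n y; rewrite distrC in fy.
have -> : f x - f y = (f x - F n x) + (F n x - F n y) + (F n y - f y) by ring.
apply: le_lt_trans (ler_normD _ _) _.
by have := ler_normD (f x - F n x) (F n x - F n y); lra.
Qed.

End GeometricConvergence.

Section ComplexModulus.
Variable R : realType.
Implicit Types z w : R[i].
Local Notation normc := ComplexField.Normc.normc.

Lemma normc_sqrt z : normc z = Num.sqrt (complex.Re z ^+ 2 + complex.Im z ^+ 2).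
Proof. by case: z. Qed.

Lemma normc_ge0 z : 0 <= normc z.
Proof. by rewrite normc_sqrt sqrtr_ge0. Qed.

Lemma normc_sqr z : normc z ^+ 2 = complex.Re z ^+ 2 + complex.Im z ^+ 2.
Proof. by rewrite normc_sqrt sqr_sqrtr// addr_ge0 ?sqr_ge0. Qed.

Lemma normc_le_sum z : normc z <= `|complex.Re z| + `|complex.Im z|.
Proof.
rewrite -(@ler_pXn2r _ 2) ?nnegrE ?normc_ge0 ?addr_ge0//.
rewrite normc_sqr -(real_normK (num_real (complex.Re z))).
rewrite -(real_normK (num_real (complex.Im z))).
by have := normr_ge0 (complex.Re z); have := normr_ge0 (complex.Im z); nra.
Qed.

Lemma Re_le_normc z : `|complex.Re z| <= normc z.
Proof.
rewrite -(@ler_pXn2r _ 2) ?nnegrE ?normc_ge0//.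
by rewrite normc_sqr real_normK ?num_real// lerDl sqr_ge0.
Qed.

Lemma Im_le_normc z : `|complex.Im z| <= normc z.
Proof.
rewrite -(@ler_pXn2r _ 2) ?nnegrE ?normc_ge0//.
by rewrite normc_sqr real_normK ?num_real// lerDr sqr_ge0.
Qed.

Lemma dot_le_normc w z :
  complex.Re w * complex.Re z + complex.Im w * complex.Im z <= normc w * normc z.
Proof.
have [|s0] := leP (complex.Re w * complex.Re z + complex.Im w * complex.Im z) 0.
  by move=> /le_trans; apply; rewrite mulr_ge0 ?normc_ge0.
rewrite -(@ler_pXn2r _ 2) ?nnegrE ?mulr_ge0 ?normc_ge0 ?(ltW s0)//.
rewrite exprMn !normc_sqr -subr_ge0.
have -> : (complex.Re w ^+ 2 + complex.Im w ^+ 2) *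
    (complex.Re z ^+ 2 + complex.Im z ^+ 2) -
    (complex.Re w * complex.Re z + complex.Im w * complex.Im z) ^+ 2 =
    (complex.Re w * complex.Im z - complex.Im w * complex.Re z) ^+ 2 by ring.
exact: sqr_ge0.
Qed.

End ComplexModulus.

(** * Spectral radius of a positive operator with a positive eigenfunction *)

Section PositiveOperator.
Variable R : realType.
Local Notation X := (seqspace R).
Local Notation normc := ComplexField.Normc.normc.
Variables (L : (X -> R) -> X -> R) (h : X -> R) (l : R).
Hypothesis L_continuous : forall f : X -> R, continuous f -> continuous (L f).
Hypothesis LD : forall f g : X -> R, continuous f -> continuous g ->
  forall x, L (fun t => f t + g t) x = L f x + L g x.
Hypothesis LZ : forall (c : R) (f : X -> R), continuous f ->
  forall x, L (fun t => c * f t) x = c * L f x.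
Hypothesis L_le : forall f g : X -> R, continuous f -> continuous g ->
  (forall t, f t <= g t) -> forall x, L f x <= L g x.
Hypothesis h_continuous : continuous h.
Hypothesis h_gt0 : forall x, 0 < h x.
Hypothesis l_gt0 : 0 < l.
Hypothesis Lh : forall x, L h x = l * h x.
Implicit Types (f g : X -> R[i]) (w z : R[i]) (B : R).

Let LB (f g : X -> R) : continuous f -> continuous g ->
  forall x, L (fun t => f t - g t) x = L f x - L g x.
Proof.
move=> cf cg x.
have cNg := continuousZc (c := -1) cg.
have := LD cf cNg x; rewrite LZ// mulN1r => <-.
by congr L; apply/funext => t; rewrite mulN1r.
Qed.

(** Domination by multiples of the eigenfunction is a norm, equivalent to the
    sup norm, for which the operator has norm at most the eigenvalue. *)
Definition hdom B f := forall x, normc (f x) <= B * h x.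

Lemma ccontinuous_hdom f : ccontinuous f -> exists B, hdom B f.
Proof.
move=> [cr ci].
have [M1 fM1] := compact_bounded_fun (@compact_seqspace R) cr.
have [M2 fM2] := compact_bounded_fun (@compact_seqspace R) ci.
have [| y _ hy] := compact_EVT_min _ (@compact_seqspace R)
    (continuous_subspaceT h_continuous); first by exists point.
exists ((M1 + M2) / h y) => x.
apply: le_trans (normc_le_sum _) _.
apply: (@le_trans _ _ (M1 + M2)); first exact: lerD.
have M0 : 0 <= M1 + M2.
  by apply: addr_ge0; [exact: le_trans (fM1 x)|exact: le_trans (fM2 x)].
by rewrite mulrAC ler_pdivlMr// ler_wpM2l// hy// inE.
Qed.

Lemma ccontinuousB f g : ccontinuous f -> ccontinuous g ->
  ccontinuous (fun x => f x - g x).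
Proof.
move=> [f1 f2] [g1 g2]; split.
  have -> : (fun x => complex.Re (f x - g x)) =
    (fun x => complex.Re (f x) - complex.Re (g x)).
    by apply/funext => x; case: (f x) (g x) => a b [].
  exact: continuousBf.
have -> : (fun x => complex.Im (f x - g x)) =
  (fun x => complex.Im (f x) - complex.Im (g x)).
  by apply/funext => x; case: (f x) (g x) => a b [].
exact: continuousBf.
Qed.

Lemma ccontinuous_affine w f g : ccontinuous f -> ccontinuous g ->
  ccontinuous (fun x => w * (g x + f x)).
Proof.
move=> [f1 f2] [g1 g2].
have rD x : complex.Re (g x + f x) = complex.Re (g x) + complex.Re (f x).
  by case: (f x) (g x) => a b [].
have iD x : complex.Im (g x + f x) = complex.Im (g x) + complex.Im (f x).
  by case: (f x) (g x) => a b [].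
split.
  have -> : (fun x => complex.Re (w * (g x + f x))) =
    (fun x => complex.Re w * (complex.Re (g x) + complex.Re (f x)) -
              complex.Im w * (complex.Im (g x) + complex.Im (f x))).
    by apply/funext => x; rewrite -rD -iD; case: w (g x + f x) => a b [].
  by apply: continuousBf; apply: continuousZc; exact: continuousDf.
have -> : (fun x => complex.Im (w * (g x + f x))) =
  (fun x => complex.Re w * (complex.Im (g x) + complex.Im (f x)) +
            complex.Im w * (complex.Re (g x) + complex.Re (f x))).
  apply/funext => x; rewrite -rD -iD; case: w (g x + f x) => a b [c d] /=.
  by congr (_ + _); rewrite mulrC.
by apply: continuousDf; apply: continuousZc; exact: continuousDf.
Qed.

Lemma ccontinuous_complexify f : ccontinuous f -> ccontinuous (complexify L f).
Proof. by move=> [f1 f2]; split; exact: L_continuous. Qed.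

Lemma complexifyB f g : ccontinuous f -> ccontinuous g -> forall x,
  complexify L (fun t => f t - g t) x = complexify L f x - complexify L g x.
Proof.
move=> [f1 f2] [g1 g2] x; rewrite /complexify.
have -> : (fun x => complex.Re (f x - g x)) =
  (fun x => complex.Re (f x) - complex.Re (g x)).
  by apply/funext => t; case: (f t) (g t) => a b [].
have -> : (fun x => complex.Im (f x - g x)) =
  (fun x => complex.Im (f x) - complex.Im (g x)).
  by apply/funext => t; case: (f t) (g t) => a b [].
by rewrite !LB.
Qed.

(** Positivity gives the bound for the modulus without a constant: rotate the
    value at [x] to the positive real axis, and compare real parts. *)
Lemma complexify_hdom B f : ccontinuous f -> hdom B f ->
  hdom (l * B) (complexify L f).
Proof.
move=> [f1 f2] fB x; set v := complexify L f x.
have Bh0 : 0 <= B * h x by apply: le_trans (fB x); exact: normc_ge0.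
have [v0|v0] := eqVneq (normc v) 0.
  by rewrite v0 mulrAC -mulrA mulr_ge0 ?(ltW l_gt0)//= mulrC.
have v0' : 0 < normc v by rewrite lt_neqAle eq_sym v0 normc_ge0.
rewrite -(ler_pM2l v0') -expr2 normc_sqr.
pose k t := complex.Re v * complex.Re (f t) + complex.Im v * complex.Im (f t).
have -> : complex.Re v ^+ 2 + complex.Im v ^+ 2 = L k x.
  by rewrite /k LD; [|exact: continuousZc..]; rewrite !LZ// !expr2.
have -> : normc v * (l * B * h x) = L (fun t => normc v * B * h t) x.
  by rewrite LZ// Lh; ring.
apply: L_le; last first.
- move=> t; apply: le_trans (dot_le_normc _ _) _.
  by rewrite -mulrA ler_pM2l.
- exact: continuousZc.
- by apply: continuousDf; exact: continuousZc.
Qed.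

Section Resolvent.
Variable z : R[i].
Hypothesis lz : l < normc z.

Let nz0 : 0 < normc z. Proof. exact: lt_trans lz. Qed.
Let z0 : z != 0.
Proof. by apply: contraTneq nz0 => ->; rewrite ComplexField.Normc.normc0 ltxx. Qed.
Let r := l / normc z.
Let r01 : 0 <= r < 1.
Proof. by rewrite divr_ge0 ?ltW//= ltr_pdivrMr// mul1r. Qed.

Let Phi g f x := z^-1 * (g x + complexify L f x).

Let PhiP g f x : (z * f x - complexify L f x = g x) <-> f x = Phi g f x.
Proof.
rewrite /Phi; split => [<-|->]; first by rewrite subrK mulKf.
by rewrite mulVKf// addrK.
Qed.

Let Phi_contract g f1 f2 B : ccontinuous f1 -> ccontinuous f2 ->
  hdom B (fun x => f1 x - f2 x) -> hdom (r * B) (fun x => Phi g f1 x - Phi g f2 x).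
Proof.
move=> c1 c2 fB x; rewrite /Phi -mulrBr opprD addrACA subrr add0r.
rewrite -complexifyB// ComplexField.Normc.normcM ComplexField.Normc.normcV.
have -> : r * B * h x = (normc z)^-1 * (l * B * h x) by rewrite /r; ring.
rewrite ler_wpM2l ?invr_ge0 ?normc_ge0//.
exact: complexify_hdom (ccontinuousB c1 c2) fB x.
Qed.

Let geom_eq0 f B : (forall n, hdom (B * r ^+ n) f) -> forall x, f x = 0.
Proof.
move=> fB x; apply: ComplexField.Normc.eq0_normc.
apply/le_anti; rewrite normc_ge0 andbT.
apply: (le_geometric_eq0 (C := B * h x) r01) => n.
by rewrite mulrAC; exact: fB.
Qed.

(** For [l < |z|] the equation is a fixed point problem for a contraction of
    ratio [l / |z|] in the norm given by [hdom]. *)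
Lemma resolvent_exists_unique g : ccontinuous g ->
  exists! f, ccontinuous f /\ forall x, z * f x - complexify L f x = g x.
Proof.
move=> cg.
have cPhi f : ccontinuous f -> ccontinuous (Phi g f).
  by move=> cf; apply: ccontinuous_affine => //; exact: ccontinuous_complexify.
pose F n := iter n (Phi g) (fun=> 0).
have cF n : ccontinuous (F n).
  elim: n => [|n IH] /=; last exact: cPhi.
  by split; exact: cst_continuous.
have [B0 FB0] := ccontinuous_hdom (ccontinuousB (cF 1%N) (cF 0%N)).
have FB n : hdom (B0 * r ^+ n) (fun x => F n.+1 x - F n x).
  elim: n => [|n IH]; first by rewrite expr0 mulr1.
  by rewrite exprS mulrCA; exact: (Phi_contract g (cF n.+1) (cF n) IH).
have [H hH] := compact_bounded_fun (@compact_seqspace R) h_continuous.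
have B00 : 0 <= B0.
  have := le_trans (normc_ge0 _) (FB0 point).
  by rewrite pmulr_lge0.
have FH n x : normc (F n.+1 x - F n x) <= B0 * H * r ^+ n.
  apply: le_trans (FB n x) _; rewrite mulrAC ler_wpM2r ?exprn_ge0//.
    by case/andP: r01.
  by rewrite ler_wpM2l// (le_trans (ler_norm _)).
have ReB (a b : R[i]) : complex.Re (a - b) = complex.Re a - complex.Re b.
  by case: a b => a1 a2 [].
have ImB (a b : R[i]) : complex.Im (a - b) = complex.Im a - complex.Im b.
  by case: a b => a1 a2 [].
have PH n x : `|complex.Re (F n.+1 x) - complex.Re (F n x)| <= B0 * H * r ^+ n.
  by rewrite -ReB; apply: le_trans (Re_le_normc _) (FH n x).
have [P PF] := geometric_cvg (F := fun n x => complex.Re (F n x)) r01 PH.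
have QH n x : `|complex.Im (F n.+1 x) - complex.Im (F n x)| <= B0 * H * r ^+ n.
  by rewrite -ImB; apply: le_trans (Im_le_normc _) (FH n x).
have [Q QF] := geometric_cvg (F := fun n x => complex.Im (F n x)) r01 QH.
pose f x := (P x +i* Q x)%C.
have cf : ccontinuous f.
  by split; apply: geometric_limit_continuous r01 _ _;
    [move=> n; exact: (cF n).1|exact: PF|move=> n; exact: (cF n).2|exact: QF].
have [E0 E0P] : exists E, forall n, hdom (E * r ^+ n) (fun x => f x - F n x).
  have [| y _ hy] := compact_EVT_min _ (@compact_seqspace R)
    (continuous_subspaceT h_continuous); first by exists point.
  set D := B0 * H / (1 - r) in PF QF.
  exists (2 * D / h y) => n x.
  apply: le_trans (normc_le_sum _) _; rewrite ReB ImB.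
  apply: le_trans (lerD (PF n x) (QF n x)) _.
  have D0 : 0 <= D * r ^+ n by apply: le_trans (PF n x).
  have -> : 2 * D / h y * r ^+ n * h x = (2 * (D * r ^+ n)) * (h x / h y) by ring.
  have q1 : 1 <= h x / h y by rewrite ler_pdivlMr// mul1r hy// inE.
  by have := ler_wpM2l D0 q1; lra.
have NB (a b : R[i]) : normc (a - b) <= normc a + normc b.
  apply: le_trans (@le_normcD R a (- b)) _; rewrite lerD2l.
  by rewrite (_ : normc (- b) = normc b)//; exact: normcN.
have fPhi x : f x = Phi g f x.
  apply/eqP; rewrite -subr_eq0; apply/eqP; move: x.
  apply: (geom_eq0 (B := E0 * r + r * E0)) => n x.
  have -> : f x - Phi g f x = (f x - F n.+1 x) - (Phi g f x - Phi g (F n) x).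
    by rewrite opprB addrA subrK.
  apply: le_trans (NB _ _) _.
  have := E0P n.+1 x; have := Phi_contract g cf (cF n) (E0P n) x.
  by rewrite exprS; lra.
exists f; split; first by split=> // x; apply/PhiP.
move=> f' [cf' f'P]; apply/funext => x; apply/eqP; rewrite -subr_eq0; apply/eqP.
move: x; have [B fB] := ccontinuous_hdom (ccontinuousB cf cf').
apply: (geom_eq0 (B := B)); elim=> [|n IH]; first by rewrite expr0 mulr1.
rewrite exprS mulrCA => x.
have f'Phi : f' x = Phi g f' x by apply/PhiP.
by rewrite fPhi f'Phi; exact: (Phi_contract g cf cf' IH).
Qed.

End Resolvent.

(** The eigenvalue is in the spectrum because the homogeneous equation has the
    solutions 0 and [h]; nothing of larger modulus is. *)
Theorem spectral_radius_eigenvalue : spectral_radius L = l.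
Proof.
have ub : ubound [set normc z | z in spectrum L] l.
  move=> _ [z zL <-]; rewrite leNgt; apply/negP => lz; apply: zL => g cg.
  exact: resolvent_exists_unique.
have in_spec : [set normc z | z in spectrum L] l.
  exists (l +i* 0)%C; last by rewrite normc_sqrt /= expr0n addr0 sqrtr_sqr gtr0_norm.
  move=> /(_ (fun=> 0))[]; first by split; exact: cst_continuous.
  move=> f [_ fU].
  have L0 x : L (fun=> 0) x = 0.
    rewrite -[RHS](mul0r (L h x)) -LZ//.
    by congr L; apply/funext => t; rewrite mul0r.
  have f0 : f = fun=> 0.
    apply: fU; split; first by split; exact: cst_continuous.
    by move=> x; rewrite /complexify /= L0 mulr0 subrr.
  have fh : f = fun x => (h x +i* 0)%C.
    apply: fU; split.
      by split; [exact: h_continuous|exact: cst_continuous].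
    move=> x; rewrite /complexify /= Lh L0.
    by apply/eqP; rewrite eq_complex /= !(mulr0, mul0r, subr0, addr0) subrr eqxx.
  have := h_gt0 point.
  have : (h point +i* 0)%C = 0 :> R[i] by rewrite -[LHS](congr1 (@^~ point) fh) f0.
  by case=> ->; rewrite ltxx.
apply/le_anti/andP; split; first by apply: ge_sup => //; exists l.
by apply: ub_le_sup => //; exists l.
Qed.

Theorem main_eigenvalueE : main_eigenvalue L = l.
Proof.
rewrite /main_eigenvalue; case: xgetP => [l' _ [_ -> _]|/(_ l) []].
  exact: spectral_radius_eigenvalue.
by split; rewrite ?spectral_radius_eigenvalue//; exists h.
Qed.

End PositiveOperator.

(** * The Ruelle operator at large inverse temperature *)

Section RuelleOperator.
Variable R : realType.
Local Notation X := (seqspace R).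
Implicit Types (f g A B u v : X -> R) (c K m b d : R).

Lemma continuous_fibre f x : continuous f -> continuous (fibre f x).
Proof.
move=> cf a U /cf /(@nbhs_ballP R X)[e /= e0 eU].
apply/(@nbhs_ballP R (circle R)); exists e => // a' aa'; apply: eU.
by move: aa'; rewrite !ballEmdist /= mdist_prepend1.
Qed.

Section Weight.
Variable B : X -> R.
Hypothesis cB : continuous B.

Let cw f : continuous f -> continuous (fun y => expR (B y) * f y).
Proof.
by move=> cf; apply: continuousMf => //; exact: continuous_expR_comp.
Qed.

Let cwf f x : continuous f ->
  continuous (fun a => expR (B (prepend a x)) * f (prepend a x)).
Proof. by move=> cf; exact: (continuous_fibre (x := x) (cw cf)). Qed.

Lemma ruelle_continuous f : continuous f -> continuous (ruelle B f).
Proof.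
move=> cf; apply: mdist_continuous => x e e0.
have e2 : 0 < e / 2 by rewrite divr_gt0.
have [d d0 df] := compact_unif_cont (@compact_seqspace R) (cw cf) e2.
exists d => // y xy.
have half s t : mdist s t < d -> ruelle B f s <= ruelle B f t + e / 2.
  move=> st; rewrite -(circle_integral_cst (e / 2)) -circle_integralD; last 2 first.
  - exact: cwf.
  - exact: cst_continuous.
  apply: le_circle_integral; first exact: cwf.
    by apply: continuousDc; exact: cwf.
  move=> a; have : mdist (prepend a s) (prepend a t) < d.
    by rewrite mdist_prepend2; have := mdist_ge0 s t; lra.
  by move=> /df; rewrite ltr_norml => /andP[_ h]; lra.
have h1 := half _ _ xy; rewrite metric_sym in xy; have h2 := half _ _ xy.
by rewrite ltr_norml; apply/andP; split; lra.
Qed.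

Lemma ruelleD f g : continuous f -> continuous g ->
  forall x, ruelle B (fun t => f t + g t) x = ruelle B f x + ruelle B g x.
Proof.
move=> cf cg x; rewrite /ruelle -circle_integralD; [|exact: cwf..].
by apply: eq_Rintegral => a _; rewrite mulrDr.
Qed.

Lemma ruelleZ c f : continuous f ->
  forall x, ruelle B (fun t => c * f t) x = c * ruelle B f x.
Proof.
move=> cf x; rewrite /ruelle -circle_integralZ; last exact: cwf.
by apply: eq_Rintegral => a _; rewrite mulrCA.
Qed.

Lemma ruelle_le f g : continuous f -> continuous g ->
  (forall t, f t <= g t) -> forall x, ruelle B f x <= ruelle B g x.
Proof.
move=> cf cg fg x; apply: le_circle_integral; [exact: cwf..|].
by move=> a; rewrite ler_wpM2l ?expR_ge0.
Qed.

End Weight.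

(** A solution of the log-integral equation is the logarithm of a positive
    eigenfunction. *)
Lemma main_eigenvalue_ruelle B v c : continuous B -> continuous v ->
    (forall x, circle_logint (fibre (fun z => B z + v z) x) = v x + c) ->
  main_eigenvalue (ruelle B) = expR c.
Proof.
move=> cB cv Bv; apply: (main_eigenvalueE (h := fun x => expR (v x))).
- exact: ruelle_continuous.
- exact: ruelleD.
- exact: ruelleZ.
- exact: ruelle_le.
- exact: continuous_expR_comp.
- by move=> x; exact: expR_gt0.
- exact: expR_gt0.
- move=> x; rewrite -expRD addrC -Bv expR_circle_logint; last first.
    by apply: continuous_fibre; exact: continuousDf.
  by apply: eq_Rintegral => a _; rewrite /fibre expRD.
Qed.

(** The eigenfunction equations at inverse temperature [b] and at zero
    temperature are compared at the extrema of [v - b * u]. *)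
Lemma log_eigenvalue_bounds A u v K m c b d : 0 <= K -> 0 < b -> 0 < d <= 2^-1 ->
    klip K A -> klip K u -> continuous v ->
    (forall x, circle_max (fibre (fun z => A z + u z) x) = u x + m) ->
    (forall x, circle_logint (fibre (fun z => b * A z + v z) x) = v x + c) ->
  b * m - b * (K + K) * d + ln d <= c <= b * m.
Proof.
move=> K0 b0 d02 AK uK cv Au Bv.
have cA := klip_continuous AK; have cu := klip_continuous uK.
have cAu x : continuous (fibre (fun z => A z + u z) x).
  by apply: continuous_fibre; exact: continuousDf.
have cBv x : continuous (fibre (fun z => b * A z + v z) x).
  by apply: continuous_fibre; apply: continuousDf => //; exact: continuousZc.
have cvu : continuous (fun x => v x - b * u x).
  by apply: continuousBf => //; exact: continuousZc.
apply/andP; split.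
  have [|y _ ymin] := compact_EVT_min _ (@compact_seqspace R)
    (continuous_subspaceT cvu); first by exists point.
  have {}ymin t : v y - b * u y <= v t - b * u t by apply: ymin; rewrite inE.
  have [a0 amax _] := circle_maxP (@cAu y).
  have bAuK : klip (b * (K + K)) (fibre (fun z => b * (A z + u z)) y).
    move=> a a'; have := klip_fibre y (klipD AK uK) a a'.
    by move=> /(ler_wpM2l (ltW b0)); rewrite /fibre mulrBr mulrA.
  have cbAu := klip_continuous bAuK.
  have := circle_logint_ge a0 cbAu _ bAuK d02.
  rewrite mulr_ge0 ?addr_ge0 ?(ltW b0)// => /(_ isT).
  have : circle_logint (fibre (fun z => b * (A z + u z)) y) + (v y - b * u y) <= v y + c.
    have [Phi_le Phi_add] := topical_circle_logint R.
    rewrite -Bv -Phi_add//; apply: Phi_le => //; first exact: continuousDc.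
    by move=> a; have := ymin (prepend a y); rewrite /fibre mulrDr; lra.
  have : b * (A (prepend a0 y) + u (prepend a0 y)) = b * (u y + m).
    by rewrite -Au amax.
  by rewrite /fibre mulrDr; lra.
have [|y _ ymax] := compact_EVT_max _ (@compact_seqspace R)
  (continuous_subspaceT cvu); first by exists point.
have {}ymax t : v t - b * u t <= v y - b * u y by apply: ymax; rewrite inE.
have : circle_logint (fibre (fun z => b * A z + v z) y) <= b * (u y + m) + (v y - b * u y).
  apply: circle_logint_le => // a; rewrite -Au.
  have [a0 -> amax] := circle_maxP (@cAu y).
  have := ler_wpM2l (ltW b0) (amax a).
  by have := ymax (prepend a y); rewrite /fibre !mulrDr; lra.
by rewrite Bv mulrDr; lra.
Qed.

Lemma lipschitz_klip f : lipschitz_fun f <-> exists2 K, 0 <= K & klip K f.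
Proof.
split=> [[K fK]|[K K0 fK]]; last by exists K => x y; exact: klip_norm.
exists `|K| => // x y; apply: le_trans (ler_norm _) _.
apply: le_trans (fK x y) _; rewrite ler_wpM2r ?mdist_ge0//; exact: ler_norm.
Qed.

End RuelleOperator.

Theorem theorem11 (R : realType) (A : seqspace R -> R) (hA : lipschitz_fun A) :
  (exists u : seqspace R -> R, lipschitz_fun u /\ calibrated_subaction A u) /\
  (b^-1 * ln (main_eigenvalue (ruelle (fun x => b * A x))) @[b --> +oo]
     --> max_integral A).
Proof.
have [K K0 AK] := (lipschitz_klip A).1 hA.
have [u [m [uK Au]]] := transfer_eigenproblem (topical_circle_max R) K0 AK.
have mE := max_integralE K0 AK uK Au.
split.
  exists u; split; first by apply/lipschitz_klip; exists K.
  exact: calibrated_of_eigenproblem uK Au.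
rewrite mE; apply/cvgrPdist_lt => e e0.
(* the length of arc for which the Laplace error is below e / 2; once it is
   fixed, ln d / b is small for large b *)
pose d := Num.min 2^-1 (e / (2 * (K + K + 1))).
have K1 : 0 < 2 * (K + K + 1) by lra.
have d0 : 0 < d by rewrite lt_min invr_gt0 ltr0n divr_gt0.
have d2 : d <= 2^-1 by rewrite ge_min lexx.
have dK : (K + K) * d < e / 2.
  have : 2 * (K + K + 1) * d <= e.
    by rewrite mulrC -ler_pdivlMr// ge_min lexx orbT.
  lra.
near=> b.
have b0 : 0 < b by near: b; exact: nbhs_pinfty_gt.
have bln : - ln d < b * (e / 2).
  rewrite -ltr_pdivrMr ?divr_gt0//; near: b; apply: nbhs_pinfty_gt.
  exact: num_real.
have bAK : klip (b * K) (fun x => b * A x).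
  by move=> x y; rewrite -mulrBr -mulrA ler_wpM2l// ltW.
have [|v [c [vK Bv]]] := transfer_eigenproblem (topical_circle_logint R) _ bAK.
  by rewrite mulr_ge0// ltW.
have cv := klip_continuous vK.
rewrite (main_eigenvalue_ruelle (klip_continuous bAK) cv Bv) expRK.
have /andP[lo hi] : b * m - b * (K + K) * d + ln d <= c <= b * m.
  by apply: (log_eigenvalue_bounds K0 b0 _ AK uK cv Au Bv); rewrite d0.
have -> : m - b^-1 * c = b^-1 * (b * m - c) by field; rewrite gt_eqF.
rewrite ger0_norm ?mulr_ge0 ?invr_ge0 ?subr_ge0 ?(ltW b0)//.
rewrite mulrC ltr_pdivrMr//.
have := ltr_pM2l b0 ((K + K) * d) (e / 2); rewrite dK => h.
have {}h : b * ((K + K) * d) < b * (e / 2) by rewrite h.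
by lra.
Unshelve. all: by end_near. Qed.
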